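(* Let $Q$ be a mutation-cyclic quiver with $3$ vertices. Then every $c$-vector $(x_1,x_2,x_3)$ of $Q$ (obtained from any mutation sequence) is a solution to a quadratic equation of the form $$\sum_{i=1}^3 x_i^2+\sum_{1\le i<j\le 3}\pm q_{ij}x_ix_j=1$$ (for some choice of the signs $\pm$), where $q_{ij}$ is the number of arrows between the vertices $i$ and $j$ in $Q$.
   Context: A quiver on the vertex set $\{1,\dots,n\}$ (no loops, no oriented 2-cycles) is identified with an $n\times n$ skew-symmetric integer matrix $B=[b_{ij}]$: if $b_{ij}>0$ there are $b_{ij}$ arrows from $i$ to $j$. Mutation: for an $n\times 2n$ integer matrix $M=[m_{ij}]$ and $k\in\{1,\dots,n\}$, the mutation of $M$ at $k$ is the matrix with entries $-m_{ij}$ if $i=k$ or $j=k$, and $m_{ij}+\mathrm{sgn}(m_{ik})\max(m_{ik}m_{kj},0)$ otherwise. A mutation sequence $\boldsymbol{w}=[i_1,\dots,i_\ell]$ (possibly empty) means mutating at $i_1$, then $i_2$, etc. Starting from $[B\mid I]$, the result after $\boldsymbol{w}$ is written $[B^{\boldsymbol{w}}\mid C^{\boldsymbol{w}}]$; the rows of $C^{\boldsymbol{w}}$, for all $\boldsymbol{w}$, are the $c$-vectors of $B$. Two quivers are mutation-equivalent if one is obtained from the other by a mutation sequence ($B\mapsto B^{\boldsymbol{w}}$). A quiver is mutation-acyclic if it is mutation-equivalent to an acyclic quiver (one without oriented cycles), and mutation-cyclic otherwise. *)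

(* Defs.v *)
From HB Require Import structures.
From mathcomp Require Import all_boot all_order all_algebra.

Set Implicit Arguments.
Unset Strict Implicit.
Unset Printing Implicit Defensive.

Import Order.TTheory GRing.Theory Num.Theory.

Local Open Scope ring_scope.

(* A quiver on the vertices 'I_n without loops and oriented 2-cycles is a
   skew-symmetric integer matrix B; a positive entry B i j counts the arrows
   from i to j. *)
Definition is_quiver (n : nat) (B : 'M[int]_n) : Prop := B^T = - B.

Definition arrow (n : nat) (B : 'M[int]_n) : rel 'I_n :=
  fun i j => 0 < B i j.

(* Since B is skew-symmetric, all arrows between i and j have the same
   direction, and there are |B i j| of them. *)
Definition num_arrows (n : nat) (B : 'M[int]_n) (i j : 'I_n) : nat :=
  `|B i j|%N.

(* [path.cycle] holds for the empty sequence, which is not an oriented cycle. *)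
Definition acyclic (n : nat) (B : 'M[int]_n) : Prop :=
  forall c : seq 'I_n, cycle (arrow B) c -> c = [::].

(* The columns of M are indexed by 'I_(n + n); column k of the left block is
   lshift n k. *)
Definition mutation (n : nat) (k : 'I_n) (M : 'M[int]_(n, n + n)) :
    'M[int]_(n, n + n) :=
  \matrix_(i, j)
    if (i == k) || (j == lshift n k) then - M i j
    else M i j + Num.sg (M i (lshift n k))
                 * Num.max (M i (lshift n k) * M k j) 0.

Definition mutation_seq (n : nat) (w : seq 'I_n) (M : 'M[int]_(n, n + n)) :
    'M[int]_(n, n + n) :=
  foldl (fun M' k => mutation k M') M w.

(* mutation_seq w [B | I] = [Bmx B w | Cmx B w] *)
Definition Bmx (n : nat) (B : 'M[int]_n) (w : seq 'I_n) : 'M[int]_n :=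
  lsubmx (mutation_seq w (row_mx B 1%:M)).

Definition Cmx (n : nat) (B : 'M[int]_n) (w : seq 'I_n) : 'M[int]_n :=
  rsubmx (mutation_seq w (row_mx B 1%:M)).

Definition c_vector (n : nat) (B : 'M[int]_n) (x : 'rV[int]_n) : Prop :=
  exists (w : seq 'I_n) (i : 'I_n), x = row i (Cmx B w).

Definition mutation_equivalent (n : nat) (B B' : 'M[int]_n) : Prop :=
  exists w : seq 'I_n, B' = Bmx B w.

Definition mutation_acyclic (n : nat) (B : 'M[int]_n) : Prop :=
  exists B' : 'M[int]_n, mutation_equivalent B B' /\ acyclic B'.

Definition mutation_cyclic (n : nat) (B : 'M[int]_n) : Prop :=
  ~ mutation_acyclic B.

(* Main.v *)
(* Fix the first mutated vertex k, and let A be the symmetric matrix with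
   diagonal 2 and off-diagonal entries -|b_ij| if k is i or j, and |b_ij|
   otherwise.  Along every reduced mutation sequence starting with k, each
   mutation acts on the rows of C as a reflection for A, up to the sign of the
   mutated row, so every c-vector x satisfies x A x^T = 2.  This needs the
   inner product of the mutated row and the changed row to have the right sign.
   The signs of the inner products are governed by the signs of the rows, and
   these are controlled because every mutation-equivalent quiver is a 3-cycle
   with all weights at least 2: the row changed by a mutation then dominates
   the mutated one and keeps this property under all further mutations. *)

Require Import Defs.
From mathcomp Require Import all_boot all_order all_algebra.
From mathcomp Require Import zify ring.

Set Implicit Arguments.
Unset Strict Implicit.
Unset Printing Implicit Defensive.

Import Order.TTheory GRing.Theory Num.Theory.
Local Open Scope ring_scope.

Local Notation arr M i j := (M i (lshift 3 j)).
Local Notation cvec M i := (row i (rsubmx M)).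

Definition sign (e : int) := e = 1 \/ e = -1.

(** * Case analysis on three vertices *)

Lemma ord3_ind (P : 'I_3 -> Prop) :
  P ord0 -> P (lift ord0 ord0) -> P (lift ord0 (lift ord0 ord0)) ->
  forall i, P i.
Proof.
move=> P0 P1 P2 [[|[|[|//]]] hi].
- by rewrite (_ : Ordinal hi = ord0) //; apply: val_inj.
- by rewrite (_ : Ordinal hi = lift ord0 ord0) //; apply: val_inj.
- by rewrite (_ : Ordinal hi = lift ord0 (lift ord0 ord0)) //; apply: val_inj.
Qed.

Lemma ord3_third (k x o u : 'I_3) :
  uniq [:: k; x; o] -> u != k -> u = x \/ u = o.
Proof.
elim/ord3_ind: k; elim/ord3_ind: x; elim/ord3_ind: o => //= _;
  elim/ord3_ind: u => // _; by [left | right].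
Qed.

Lemma ord3_complete (k : 'I_3) : exists y z, uniq [:: y; k; z].
Proof.
elim/ord3_ind: k.
- by exists (lift ord0 ord0), (lift ord0 (lift ord0 ord0)).
- by exists ord0, (lift ord0 (lift ord0 ord0)).
- by exists ord0, (lift ord0 ord0).
Qed.

(** * Reduced mutation sequences and skew-symmetry *)

Lemma mutationK (n : nat) (k : 'I_n) : involutive (mutation k).
Proof.
move=> M; apply/matrixP => i j; rewrite !mxE eqxx orbT /=.
case: (eqVneq i k) => [->|ik] /=; first by rewrite opprK.
case: (eqVneq j (lshift n k)) => [->|jk] /=; first by rewrite opprK.
by rewrite eqxx /= mulrNN sgrN mulNr addrK.
Qed.

(** Two consecutive mutations at one vertex cancel. The invariant below passes only to a mutation at
    a vertex other than the last one. *)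
Lemma reduced_mutation_seq (n : nat) (w : seq 'I_n) : exists2 w',
  sorted (fun i j => j != i) w' &
  forall M, mutation_seq w M = mutation_seq w' M.
Proof.
elim: w => [|k w [w' sw' eqw]]; first by exists [::].
case: w' sw' eqw => [|i w'] sw' eqw.
  by exists [:: k] => // M; rewrite /mutation_seq /= -/(mutation_seq w _) eqw.
case: (eqVneq i k) => [ik|ik].
  exists w' => [|M]; first exact: (path_sorted sw').
  by rewrite /mutation_seq /= -/(mutation_seq w _) eqw /mutation_seq /=
    ik mutationK.
exists [:: k, i & w'] => [|M]; first by rewrite /= ik.
by rewrite /mutation_seq /= -/(mutation_seq w _) eqw.
Qed.

Lemma skewE (n : nat) (B : 'M[int]_n) :
  is_quiver B -> forall i j, B i j = - B j i.
Proof. by move=> /matrixP skB i j; have := skB j i; rewrite !mxE. Qed.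

Lemma skew_mutation (n : nat) (k : 'I_n) (M : 'M[int]_(n, n + n)) :
  is_quiver (lsubmx M) -> is_quiver (lsubmx (mutation k M)).
Proof.
move=> skM; apply/matrixP => i j; rewrite !mxE.
have sk p q : M p (lshift n q) = - M q (lshift n p).
  by have := skewE skM p q; rewrite !mxE.
rewrite !(inj_eq (@lshift_inj _ _)) orbC.
case: ifP => _; first by rewrite sk.
rewrite (sk j i) opprD; congr (_ + _).
rewrite (sk j k) (sk k i) mulrNN sgrN mulNr [in RHS]mulrC.
rewrite [M k _ * _]mulrC [in RHS]mulrC.
case: (ltrgtP (M i (lshift n k)) 0) => Hi;
  case: (ltrgtP (M k (lshift n j)) 0) => Hj;
  rewrite ?Hi ?Hj ?mul0r ?mulr0 ?sgr0 ?maxxx ?mulr0 ?mul0r ?oppr0 //;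
  rewrite ?(ltr0_sg Hi) ?(gtr0_sg Hi) ?(ltr0_sg Hj) ?(gtr0_sg Hj) //;
  by rewrite max_r ?mulr0 ?oppr0 //; nia.
Qed.

(** * Acyclicity and oriented 3-cycles *)

Lemma acyclic_potential (n : nat) (B : 'M[int]_n) (h : 'I_n -> int) :
  (forall i j, arrow B i j -> h i < h j) -> acyclic B.
Proof.
move=> hlt [//|x c] arc.
have : path (relpre h <%R) x (rcons c x) by apply: (sub_path _ arc) => i j /hlt.
rewrite -path_map map_rcons => /(order_path_min lt_trans).
by rewrite all_rcons ltxx.
Qed.

(* The potential is in-degree minus out-degree, arrows being counted without
   multiplicity; an arrow fails to increase it only inside a 3-cycle. *)
Lemma not_acyclic3 (B : 'M[int]_3) : is_quiver B -> ~ acyclic B ->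
  exists i j k, [/\ 0 < B i j, 0 < B j k & 0 < B k i].
Proof.
move=> skB nacB; have sk := skewE skB.
pose tri := [exists i, exists j, exists k,
  [&& 0 < B i j, 0 < B j k & 0 < B k i]].
case: (boolP tri) => [/existsP[i /existsP[j /existsP[k /and3P[]]]]|notri].
  by exists i, j, k.
case: nacB; apply: (@acyclic_potential _ _ (fun i => - \sum_j Num.sg (B i j))).
move=> i j; rewrite /arrow => Bij.
have notri3 k : ~~ [&& 0 < B i j, 0 < B j k & 0 < B k i].
  apply: contra notri => ?; apply/existsP; exists i; apply/existsP; exists j.
  by apply/existsP; exists k.
rewrite !big_ord_recl !big_ord0.
have := sk ord0 ord0; have := sk (lift ord0 ord0) (lift ord0 ord0).
have := sk (lift ord0 (lift ord0 ord0)) (lift ord0 (lift ord0 ord0)).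
have := sk (lift ord0 ord0) ord0; have := sk (lift ord0 (lift ord0 ord0)) ord0.
have := sk (lift ord0 (lift ord0 ord0)) (lift ord0 ord0).
have := notri3 ord0; have := notri3 (lift ord0 ord0).
have := notri3 (lift ord0 (lift ord0 ord0)).
move: Bij; clear.
elim/ord3_ind: i; elim/ord3_ind: j; lia.
Qed.

(** Three vertices have only two cyclic orders; [e] records whether the 3-cycle runs along [y], [u],
    [z] or in reverse. *)
Lemma not_acyclic3_orient (B : 'M[int]_3) (y u z : 'I_3) :
  is_quiver B -> ~ acyclic B -> uniq [:: y; u; z] ->
  exists2 e : int, sign e &
    [/\ 0 < e * B y u, 0 < e * B u z & 0 < e * B z y].
Proof.
move=> skB /(not_acyclic3 skB) [i [j [k]]].
have sk := skewE skB.
have := sk ord0 ord0; have := sk (lift ord0 ord0) (lift ord0 ord0).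
have := sk (lift ord0 (lift ord0 ord0)) (lift ord0 (lift ord0 ord0)).
have := sk (lift ord0 ord0) ord0; have := sk (lift ord0 (lift ord0 ord0)) ord0.
have := sk (lift ord0 (lift ord0 ord0)) (lift ord0 ord0).
clear => E12 E02 E01 E2 E1 E0 [Bij Bjk Bki].
have [e [he e1 e2 e3]] : exists e : int, [/\ sign e,
    0 < e * B ord0 (lift ord0 ord0),
    0 < e * B (lift ord0 ord0) (lift ord0 (lift ord0 ord0)) &
    0 < e * B (lift ord0 (lift ord0 ord0)) ord0].
  rewrite /sign; move: Bij Bjk Bki.
  elim/ord3_ind: i; elim/ord3_ind: j; elim/ord3_ind: k => *;
    solve [exfalso; lia | exists 1; split; lia | exists (-1); split; lia].
clear Bij Bjk Bki i j k; rewrite /sign in he *.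
elim/ord3_ind: y; elim/ord3_ind: u; elim/ord3_ind: z => //= _;
 solve [ exists e => //; split; lia | exists (- e); [lia | split; lia]].
Qed.

(** * Weights of a mutation-cyclic quiver *)

Definition cyclic_class (M : 'M[int]_(3, 3 + 3)) : Prop :=
  is_quiver (lsubmx M) /\ forall w, ~ acyclic (lsubmx (mutation_seq w M)).

Lemma cyclic_class_mutation (M : 'M[int]_(3, 3 + 3)) (k : 'I_3) :
  cyclic_class M -> cyclic_class (mutation k M).
Proof.
move=> [skM nac]; split; first exact: skew_mutation.
by move=> w; apply: (nac (k :: w)).
Qed.

Lemma arr_skew (M : 'M[int]_(3, 3 + 3)) :
  cyclic_class M -> forall i j, arr M i j = - arr M j i.
Proof. by move=> [/skewE skM _] i j; have := skM i j; rewrite !mxE. Qed.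

Lemma arr_mutation_l (M : 'M[int]_(3, 3 + 3)) (u j : 'I_3) :
  arr (mutation u M) u j = - arr M u j.
Proof. by rewrite mxE eqxx. Qed.

Lemma arr_mutation_r (M : 'M[int]_(3, 3 + 3)) (u i : 'I_3) :
  arr (mutation u M) i u = - arr M i u.
Proof. by rewrite mxE eqxx orbT. Qed.

Lemma arr_mutation (M : 'M[int]_(3, 3 + 3)) (u i j : 'I_3) (s : int) :
  sign s -> i != u -> j != u ->
  0 < s * arr M i u -> 0 < s * arr M u j ->
  arr (mutation u M) i j = arr M i j + s * (arr M i u * arr M u j).
Proof.
move=> hs iu ju iu_gt0 uj_gt0; rewrite mxE (inj_eq (@lshift_inj _ _)).
rewrite (negbTE iu) (negbTE ju) /= max_l; last by nia.
by congr (_ + _ * _); case: hs iu_gt0 => ->; lia.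
Qed.

Lemma oriented (M : 'M[int]_(3, 3 + 3)) (y u z : 'I_3) :
  cyclic_class M -> uniq [:: y; u; z] ->
  exists2 e : int, sign e &
    [/\ 0 < e * arr M y u, 0 < e * arr M u z & 0 < e * arr M z y].
Proof.
move=> [skM nac] yuz.
have [e he] := not_acyclic3_orient skM (nac [::]) yuz.
by rewrite !mxE; exists e.
Qed.

(** Mutation at [u] reverses the arrows at [u]. The result is again a 3-cycle, so the arrows between
    [z] and [y] reverse too: the product of the other two weights exceeds theirs. *)
Lemma oriented_mutation (M : 'M[int]_(3, 3 + 3)) (y u z : 'I_3) (e : int) :
  cyclic_class M -> uniq [:: y; u; z] -> sign e ->
  0 < e * arr M y u -> 0 < e * arr M u z ->
  e * arr M z y < e * arr M y u * (e * arr M u z).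
Proof.
move=> cM yuz he yu_gt0 uz_gt0.
have [f hf []] := oriented (cyclic_class_mutation u cM) yuz.
have /andP[yu uz] : (y != u) && (z != u).
  by move: yuz; rewrite /= !inE => /andP[/norP[-> _]]; rewrite eq_sym => /andP[->].
have skM' := arr_skew (cyclic_class_mutation u cM).
rewrite arr_mutation_l arr_mutation_r (skM' z y) (arr_mutation he) //.
rewrite (arr_skew cM z y).
by case: hf => ->; case: he yu_gt0 uz_gt0 => ->; lia.
Qed.

Lemma uniq3_rot (T : eqType) (y u z : T) :
  uniq [:: y; u; z] -> uniq [:: u; z; y].
Proof. by rewrite -(rot_uniq 1). Qed.

(* If the weight b_yu were 1, mutating at u would force b_zy < b_uz, and
   mutating at y would force b_uz < b_zy. *)
Lemma oriented_ge2 (M : 'M[int]_(3, 3 + 3)) (y u z : 'I_3) :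
  cyclic_class M -> uniq [:: y; u; z] ->
  exists2 e : int, sign e &
    [/\ 2 <= e * arr M y u, 2 <= e * arr M u z & 2 <= e * arr M z y].
Proof.
move=> cM yuz; have uzy := uniq3_rot yuz; have zyu := uniq3_rot uzy.
have [e he [p1 p2 p3]] := oriented cM yuz; exists e => //.
have := oriented_mutation cM yuz he p1 p2.
have := oriented_mutation cM uzy he p2 p3.
have := oriented_mutation cM zyu he p3 p1.
by split; nia.
Qed.

(** * Rows of C under mutation *)

Lemma cvec_mutation_at (M : 'M[int]_(3, 3 + 3)) (u : 'I_3) :
  cvec (mutation u M) u = - cvec M u.
Proof. by apply/rowP => j; rewrite !mxE eqxx. Qed.

(** Since the entries of row [u] share the sign [s], the entrywise maxima reduce to one scalar
    factor. *)
Lemma cvec_mutation (M : 'M[int]_(3, 3 + 3)) (u i : 'I_3) (s : int) :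
  sign s -> (forall j, 0 <= s * cvec M u 0 j) -> i != u ->
  cvec (mutation u M) i =
    cvec M i + Num.max (s * arr M i u) 0 *: cvec M u.
Proof.
move=> hs uge0 iu; apply/rowP => j; have := uge0 j; rewrite !mxE.
rewrite (negbTE iu) eq_rlshift /= => cge0; congr (_ + _).
set b := arr M i u; set c := M u (rshift 3 j) in cge0 *.
case: (ltrgtP b 0) => hb.
- rewrite ltr0_sg //; case: hs cge0 => ->; nia.
- rewrite gtr0_sg //; case: hs cge0 => ->; nia.
- by rewrite hb sgr0 mul0r mulr0 maxxx mul0r.
Qed.

(** * Bilinear forms *)

Definition dot (A : 'M[int]_3) (x y : 'rV[int]_3) : int := (x *m A *m y^T) 0 0.

Lemma dotDl A x y z : dot A (x + y) z = dot A x z + dot A y z.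
Proof. by rewrite /dot !mulmxDl mxE. Qed.

Lemma dotDr A x y z : dot A z (x + y) = dot A z x + dot A z y.
Proof. by rewrite /dot linearD mulmxDr mxE. Qed.

Lemma dotNl A x y : dot A (- x) y = - dot A x y.
Proof. by rewrite /dot !mulNmx mxE. Qed.

Lemma dotNr A x y : dot A x (- y) = - dot A x y.
Proof. by rewrite /dot linearN mulmxN mxE. Qed.

Lemma dotZl A a x y : dot A (a *: x) y = a * dot A x y.
Proof. by rewrite /dot -!scalemxAl mxE. Qed.

Lemma dotZr A a x y : dot A x (a *: y) = a * dot A x y.
Proof. by rewrite /dot linearZ /= -scalemxAr mxE. Qed.

Lemma dotC A : A^T = A -> forall x y, dot A x y = dot A y x.
Proof.
move=> symA x y; rewrite /dot (_ : x *m A *m y^T = (y *m A *m x^T)^T) ?mxE //.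
by rewrite !trmx_mul trmxK symA mulmxA.
Qed.

Definition dotE := (dotDl, dotDr, dotNl, dotNr, dotZl, dotZr).

(** * The invariant along a reduced sequence *)

(* The state before a mutation at u that changes row y.  The signs of rows u
   and z are s and f; moreover s is the orientation: the quiver is the 3-cycle
   y -> u -> z -> y if s = 1 and its reverse if s = -1.  By [ready_dot_yu] the
   mutation acts on row y as the reflection in row u. *)
Record ready (A : 'M[int]_3) (M : 'M[int]_(3, 3 + 3)) (u y z : 'I_3)
    (s f : int) : Prop := Ready {
  ready_uniq : uniq [:: y; u; z];
  ready_s : sign s;
  ready_f : sign f;
  ready_yu : 2 <= s * arr M y u;
  ready_uz : 2 <= s * arr M u z;
  ready_zy : 2 <= s * arr M z y;
  ready_cu : forall j, 0 <= s * cvec M u 0 j;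
  ready_cy : forall j,
    s * cvec M u 0 j <= s * cvec M y 0 j + arr M y u * cvec M u 0 j;
  ready_cz : forall j, 0 <= f * cvec M z 0 j;
  ready_dot : forall i, dot A (cvec M i) (cvec M i) = 2;
  ready_dot_yu : dot A (cvec M y) (cvec M u) = - s * arr M y u;
  ready_dot_uz : dot A (cvec M u) (cvec M z) = - f * arr M u z;
  ready_dot_yz : dot A (cvec M y) (cvec M z) = f * arr M z y }.

(* The state right after a mutation at k that changed row x: these rows have
   opposite signs -e and e, row k is dominated by row x, and e is the
   orientation of k -> x -> o -> k as above. *)
Record mutated (A : 'M[int]_3) (M : 'M[int]_(3, 3 + 3)) (k x o : 'I_3)
    (e f : int) : Prop := Mutated {
  mutated_uniq : uniq [:: k; x; o];
  mutated_e : sign e;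
  mutated_f : sign f;
  mutated_kx : 2 <= e * arr M k x;
  mutated_xo : 2 <= e * arr M x o;
  mutated_ok : 2 <= e * arr M o k;
  mutated_ck : forall j, e * cvec M k 0 j <= 0;
  mutated_cx : forall j, - (e * cvec M k 0 j) <= e * cvec M x 0 j;
  mutated_co : forall j, 0 <= f * cvec M o 0 j;
  mutated_dot : forall i, dot A (cvec M i) (cvec M i) = 2;
  mutated_dot_kx : dot A (cvec M k) (cvec M x) = - e * arr M k x;
  mutated_dot_xo : dot A (cvec M x) (cvec M o) = - f * arr M x o;
  mutated_dot_ko : dot A (cvec M k) (cvec M o) = f * arr M o k }.

Lemma ready_mutation A M u y z s f :
  A^T = A -> cyclic_class M -> ready A M u y z s f ->
  mutated A (mutation u M) u y z s f.
Proof.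
move=> symA cM [yuz hs hf yu uz zy cu cy cz dd dyu duz dyz].
have [y_neq_u z_neq_u uyz] :
    [/\ y != u, z != u & uniq [:: u; y; z]].
  move: yuz; rewrite /= !inE (eq_sym u y) (eq_sym z u) !negb_or => /and3P[].
  by move=> /andP[-> ->] -> _.
have cM' := cyclic_class_mutation u cM.
have sk := arr_skew cM; have sk' := arr_skew cM'.
have ayz : arr (mutation u M) y z = arr M y z + s * (arr M y u * arr M u z).
  by apply: arr_mutation => //; lia.
have cyE : cvec (mutation u M) y = cvec M y + (s * arr M y u) *: cvec M u.
  by rewrite (cvec_mutation hs) // max_l //; lia.
have czE : cvec (mutation u M) z = cvec M z.
  rewrite (cvec_mutation hs) // max_r ?scale0r ?addr0 //.
  by have := sk z u; case: hs uz => ->; lia.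
have cuE := cvec_mutation_at M u.
(* The new quiver is the reversed 3-cycle, with weights still at least 2. Read in the order [u],
   [y], [z], its orientation is again [s]. *)
have [e he [yu' uz' zy']] := oriented_ge2 cM' yuz.
have eE : e = - s.
  by move: yu'; rewrite arr_mutation_r; case: he hs yu => -> [] ->; lia.
subst e.
split=> //.
- by rewrite arr_mutation_l; have := sk u y; nia.
- by have := sk' y z; nia.
- by have := sk' z u; nia.
- by move=> j; rewrite cuE; have := cu j; rewrite !mxE; lia.
- move=> j; rewrite cuE cyE; have := cy j; have := cu j; rewrite !mxE.
  by case: hs => ->; lia.
- by move=> j; rewrite czE.
- move=> i; case: (eqVneq i u) => [->|iu]; first by rewrite cuE !dotE opprK.
  have [->|->] := ord3_third uyz iu; last by rewrite czE.
  (* With a = [s * arr M y u], the value is 2 - 2a^2 + 2a^2 = 2. *)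
  rewrite cyE !dotE !dd (dotC symA (cvec M u)) dyu; ring.
- rewrite cuE cyE !dotE (dotC symA (cvec M u)) dyu dd arr_mutation_l (sk u y).
  by case: hs => ->; ring.
- rewrite cyE czE !dotE dyz duz ayz (sk y z); ring.
- rewrite cuE czE !dotE duz arr_mutation_r (sk z u); ring.
Qed.

(** The sign of row [u] and the orientation decide which row changes next: row [k] if [u = x]; if
    [u = o], row [x] when [f = e] and row [k] when [f = - e]. *)
Lemma mutated_ready A M k x o e f u :
  A^T = A -> cyclic_class M -> mutated A M k x o e f -> u != k ->
  exists y z s g, ready A M u y z s g.
Proof.
move=> symA cM [kxo he hf kx xo ok ck cx co dd dkx dxo dko] uk.
have sk := arr_skew cM; have xok := uniq3_rot kxo; have okx := uniq3_rot xok.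
have dC := dotC symA.
have [->|->] := ord3_third kxo uk.
  exists k, o, e, f; split => //; last 1 first.
  (* Let K and X be the absolute values of the entries of rows [k] and [x]. As K <= X and the weight
     is at least 2, X <= 2X - K. *)
  - move=> j; have := ck j; have := cx j; move: kx; rewrite !mxE.
    by case: he => ->; nia.
  - by move=> j; have := ck j; have := cx j; lia.
have [fe|fe] : f = e \/ f = - e by case: he hf => -> [] ->; lia.
  subst f; exists x, k, e, (- e); split => //.
  - by rewrite /sign; case: he => ->; lia.
  - move=> j; have := ck j; have := cx j; have := co j; move: xo; rewrite !mxE.
    by case: he => ->; nia.
  - by move=> j; have := ck j; lia.
  - by rewrite dC dko opprK.
  - by rewrite dC dkx.
subst f; exists k, x, (- e), e; split => //.
- by rewrite -rev_uniq.
- by rewrite sk; lia.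
- by rewrite sk; lia.
- by rewrite sk; lia.
- move=> j; have := ck j; have := cx j; have := co j; move: ok.
  by rewrite (sk k o) !mxE; case: he => ->; nia.
- by move=> j; have := ck j; have := cx j; lia.
- by rewrite dko (sk k o); ring.
- by rewrite dC dxo (sk o x); ring.
- by rewrite dkx (sk x k); ring.
Qed.

Lemma dot_cvec_mutated A M k x o e f w :
  A^T = A -> cyclic_class M -> mutated A M k x o e f ->
  path (fun i j => j != i) k w ->
  forall i, dot A (cvec (mutation_seq w M) i) (cvec (mutation_seq w M) i) = 2.
Proof.
move=> symA; elim: w M k x o e f => [|u w IH] M k x o e f cM mM /=.
  by move=> _; apply: mutated_dot mM.
move=> /andP[uk pw]; have [y [z [s [g rM]]]] := mutated_ready symA cM mM uk.
exact: IH (cyclic_class_mutation u cM) (ready_mutation symA cM rM) pw.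
Qed.

(** * The companion matrix and the initial state *)

(** A quasi-Cartan companion of [B]. Its signs are those that [ready] requires of the inner products
    of the unit vectors before the first mutation, at [k]. *)
Definition companion (B : 'M[int]_3) (k : 'I_3) : 'M[int]_3 :=
  \matrix_(i, j) if i == j then 2
                 else (-1) ^+ ((i == k) || (j == k)) * `|B i j|.

Lemma companion_sym (B : 'M[int]_3) (k : 'I_3) :
  is_quiver B -> (companion B k)^T = companion B k.
Proof.
move=> skB; apply/matrixP => i j; rewrite !mxE eq_sym orbC.
by rewrite (skewE skB j i) normrN.
Qed.

Lemma dot_row1 (A : 'M[int]_3) (i j : 'I_3) :
  dot A (row i 1%:M) (row j 1%:M) = A i j.
Proof.
by rewrite /dot -row_mul mul1mx tr_row trmx1 colE mul1mx -colE !mxE.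
Qed.

Lemma ready_initial (B : 'M[int]_3) (k : 'I_3) :
  cyclic_class (row_mx B 1%:M) ->
  exists y z, ready (companion B k) (row_mx B 1%:M) k y z 1 1.
Proof.
move=> cM.
have skB : is_quiver B by case: cM; rewrite row_mxKl.
have sk := skewE skB.
have [y [z [ykz p1 p2 p3]]] : exists y z,
    [/\ uniq [:: y; k; z], 2 <= B y k, 2 <= B k z & 2 <= B z y].
  have [y [z ykz]] := ord3_complete k.
  have [e he []] := oriented_ge2 cM ykz; rewrite !row_mxEl.
  case: he => -> yk kz zy.
    by exists y, z; split=> //; lia.
  (* For the reverse orientation, exchanging [y] and [z] makes the orientation 1, the common sign of
     the rows of the identity. *)
  exists z, y; split; first by rewrite -rev_uniq.
  - by rewrite sk; lia.
  - by rewrite sk; lia.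
  - by rewrite sk; lia.
have [yk zk yz] : [/\ y != k, z != k & y != z].
  by move: ykz; rewrite /= !inE (eq_sym z k) negb_or => /and3P[/andP[-> ->] -> _].
exists y, z; split; rewrite ?row_mxEl ?row_mxKr ?mul1r //; try by left.
- by move=> j; rewrite !mxE; case: eqP; lia.
- move=> j; rewrite !mxE !mul1r; do 2 case: eqP => _ /=; lia.
- by move=> j; rewrite !mxE; case: eqP; lia.
- by move=> i; rewrite dot_row1 mxE eqxx.
- by rewrite dot_row1 mxE (negbTE yk) eqxx orbT expr1; lia.
- by rewrite dot_row1 mxE eq_sym (negbTE zk) eqxx expr1; lia.
- rewrite dot_row1 mxE (negbTE yz) (negbTE yk) (negbTE zk) (sk y z) expr0; lia.
Qed.

(** The diagonal is 2 and each off-diagonal pair counts twice, so the value 2 of the form gives the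
    value 1 in the theorem. *)
Lemma dot_companion (B : 'M[int]_3) (k : 'I_3) (x : 'rV[int]_3) :
  is_quiver B ->
  dot (companion B k) x x =
  2 * (\sum_(i < 3) x 0 i ^+ 2
    + \sum_(i < 3) \sum_(j < 3 | (i < j)%N)
        (-1) ^+ ((i == k) || (j == k)) * (num_arrows B i j)%:Z * x 0 i * x 0 j).
Proof.
move=> skB; have symA := companion_sym k skB.
have AE (i j : 'I_3) : (i < j)%N ->
    (-1) ^+ ((i == k) || (j == k)) * (num_arrows B i j)%:Z = companion B k i j.
  by move=> ij; rewrite mxE /num_arrows abszE -[i == j]val_eqE (ltn_eqF ij).
under [X in _ = 2 * (_ + X)]eq_bigr => i _ do
  under eq_bigr => j ij do rewrite (AE i j ij).
have sA i j : companion B k i j = companion B k j i.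
  by rewrite -[in LHS]symA mxE.
have Aii i : companion B k i i = 2 by rewrite mxE eqxx.
move: (companion B k) {symA AE} sA Aii => A sA Aii.
rewrite /dot mxE (eq_bigr (fun j => (\sum_i x 0 i * A i j) * x 0 j)); last first.
  by move=> j _; rewrite !mxE.
rewrite [X in _ = 2 * (_ + X)](eq_bigr (fun i : 'I_3 => \sum_(j < 3)
  if (i < j)%N then A i j * x 0 i * x 0 j else 0)); last first.
  by move=> i _; rewrite big_mkcond.
rewrite !big_ord_recl !big_ord0 /= !Aii.
rewrite (sA (lift ord0 ord0) ord0) (sA (lift ord0 (lift ord0 ord0)) ord0).
rewrite (sA (lift ord0 (lift ord0 ord0)) (lift ord0 ord0)).
ring.
Qed.

Theorem theorem1p7 (B : 'M[int]_3) (hB : is_quiver B)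
    (hcyc : mutation_cyclic B) (x : 'rV[int]_3) (hx : c_vector B x) :
  exists s : 'I_3 -> 'I_3 -> bool,
    \sum_(i < 3) x 0 i ^+ 2
    + \sum_(i < 3) \sum_(j < 3 | (i < j)%N)
        (-1) ^+ s i j * (num_arrows B i j)%:Z * x 0 i * x 0 j = 1.
Proof.
have cM : cyclic_class (row_mx B 1%:M).
  split; first by rewrite row_mxKl.
  by move=> w acw; apply: hcyc; exists (Bmx B w); split=> //; exists w.
suff [k xx] : exists k, dot (companion B k) x x = 2.
  exists (fun i j => (i == k) || (j == k)).
  by move: xx; rewrite dot_companion //; lia.
case: hx => w [i ->]; rewrite /Cmx.
have [[|k w'] red ->] := reduced_mutation_seq w.
  (* Without mutations the rows are unit vectors, and any vertex serves as [k]. *)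
  by exists ord0; rewrite row_mxKr dot_row1 mxE eqxx.
exists k; have symA := companion_sym k hB.
have [y [z rM]] := ready_initial k cM.
exact: dot_cvec_mutated symA (cyclic_class_mutation k cM)
  (ready_mutation symA cM rM) red i.
Qed.
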